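(* Let $A\in\mathbb{R}^{d\times d}$ be symmetric positive definite, $b\in\mathbb{R}^d$ and $x_*=A^{-1}b$, the minimizer of $\frac12x^\top Ax-b^\top x$ over $\mathbb{R}^d$. If $0<c<2$, then for any initial point $x_1\in\mathbb{R}^d$ the iterates of Successive Over-Relaxation with parameter $c$ converge to $x_*$.
   Context: Successive Over-Relaxation with parameter $c$: for $k=1,2,\dots$ and for $i=1,\dots,d$ in order, $x_{k+1}[i]=c\,\xi_{k,i}+(1-c)x_k[i]$, where $\xi_{k,i}:=\frac{b_i-\sum_{j<i}A_{i,j}x_{k+1}[j]-\sum_{j>i}A_{i,j}x_k[j]}{A_{i,i}}$ and $x[i]$ denotes the $i$-th entry of $x$. *)

(* Defs.v *)
From HB Require Import structures.
From mathcomp Require Import all_boot all_order all_algebra.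
From mathcomp Require Import all_classical all_reals all_analysis.

Set Implicit Arguments.
Unset Strict Implicit.
Unset Printing Implicit Defensive.

Import Order.TTheory GRing.Theory Num.Theory.

Local Open Scope ring_scope.

Definition spd (R : realType) (d : nat) (A : 'M[R]_d) : Prop :=
  A^T = A /\ forall x : 'cV[R]_d, x != 0 -> 0 < (x^T *m A *m x) 0 0.

Definition quad_obj (R : realType) (d : nat) (A : 'M[R]_d) (b x : 'cV[R]_d) : R :=
  2^-1 * (x^T *m A *m x) 0 0 - (b^T *m x) 0 0.

Definition sor_xi (R : realType) (d : nat) (A : 'M[R]_d) (b xold xnew : 'cV[R]_d)
    (i : 'I_d) : R :=
  (b i 0 - \sum_(j < d | (j < i)%N) A i j * xnew j 0
         - \sum_(j < d | (i < j)%N) A i j * xold j 0) / A i i.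

(* The sweep runs over i in increasing order and [sor_xi] reads only the entries
   j < i of [xnew], so these equations determine [xnew]; see [sor_sweep_exists]
   and [sor_sweep_unique]. *)
Definition sor_sweep (R : realType) (d : nat) (A : 'M[R]_d) (b : 'cV[R]_d) (c : R)
    (xold xnew : 'cV[R]_d) : Prop :=
  forall i : 'I_d,
    xnew i 0 = c * sor_xi A b xold xnew i + (1 - c) * xold i 0.

(* Indices start at 0: [x k] is the mathematical iterate x_{k+1}. *)
Definition sor_iterates (R : realType) (d : nat) (A : 'M[R]_d) (b : 'cV[R]_d) (c : R)
    (x1 : 'cV[R]_d) (x : nat -> 'cV[R]_d) : Prop :=
  x 0%N = x1 /\ forall k : nat, sor_sweep A b c (x k) (x k.+1).

Lemma spd_unitmx (R : realType) (d : nat) (A : 'M[R]_d) : spd A -> A \in unitmx.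
Proof.
move=> [_ Apos]; rewrite -row_free_unit -kermx_eq0; apply/eqP/row_matrixP => i.
rewrite row0; apply/eqP; apply: contraT => v0.
have vT0 : (row i (kermx A))^T != 0 by rewrite trmx_eq0.
have vA0 : row i (kermx A) *m A = 0 by apply/sub_kermxP; exact: row_sub.
by have := Apos _ vT0; rewrite trmxK vA0 mul0mx mxE ltxx.
Qed.

Lemma sor_sweep_exists (R : realType) (d : nat) (A : 'M[R]_d) (b : 'cV[R]_d) (c : R)
  (x : 'cV[R]_d) : exists y, sor_sweep A b c x y.
Proof.
suff H m : exists y : 'cV[R]_d, forall i : 'I_d, (i < m)%N ->
    y i 0 = c * sor_xi A b x y i + (1 - c) * x i 0.
  by have [y Hy] := H d; exists y => i; exact: Hy.
elim: m => [|m [y Hy]]; first by exists 0.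
pose z : 'cV[R]_d := \col_i (if i == m :> nat
  then c * sor_xi A b x y i + (1 - c) * x i 0 else y i 0).
exists z => i; rewrite ltnS => im.
have -> : sor_xi A b x z i = sor_xi A b x y i.
  rewrite /sor_xi; congr ((_ - _ - _) / _); apply: eq_bigr => j ji.
  by rewrite mxE ltn_eqF // (leq_trans ji).
by rewrite mxE; case: eqVneq => // /negP ne; rewrite Hy // ltn_neqAle im andbT; apply/negP.
Qed.

Lemma sor_sweep_unique (R : realType) (d : nat) (A : 'M[R]_d) (b : 'cV[R]_d) (c : R)
  (x y z : 'cV[R]_d) : sor_sweep A b c x y -> sor_sweep A b c x z -> y = z.
Proof.
move=> Hy Hz; apply/colP => i; have [n] := ubnP (i : nat).
elim: n i => // n IH i; rewrite ltnS => ni; rewrite Hy Hz /sor_xi.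
congr (c * ((_ - _ - _) / _) + _); apply: eq_bigr => j ji.
by rewrite IH // (leq_trans ji).
Qed.

Lemma sor_iterates_exists (R : realType) (d : nat) (A : 'M[R]_d) (b : 'cV[R]_d)
  (c : R) (x1 : 'cV[R]_d) : exists x, sor_iterates A b c x1 x.
Proof.
have /choice[f Hf] := @sor_sweep_exists R d A b c.
by exists (fun k => iter k f x1); split.
Qed.

(* Main.v *)
(* The increment D_k = x_{k+1} - x_k of a sweep solves M D_k = b - A x_k, where
   M is the strictly lower triangle of A plus c^-1 times its diagonal.  By
   symmetry M + M^T = A + (2/c - 1) diag(A), so the sweep decreases the quadratic
   objective by exactly (1/c - 1/2) \sum_i A_ii D_k[i]^2.  The objective is bounded
   below, hence its decrements, and with them D_k, tend to 0; finally
   x_k = x_* - A^-1 M D_k tends to x_*. *)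
Require Import Defs.
From HB Require Import structures.
From mathcomp Require Import all_boot all_order all_algebra.
From mathcomp Require Import all_classical all_reals all_analysis.
From mathcomp Require Import ring lra.

Import Order.TTheory GRing.Theory Num.Theory.
Import numFieldNormedType.Exports.

Local Open Scope classical_set_scope.
Local Open Scope ring_scope.

(** A neighbourhood of [l] contains a product of entrywise neighbourhoods [P i j]; there are
    finitely many entries, so the filter contains their intersection. *)
Lemma cvg_mx (T : Type) (F : set_system T) (FF : Filter F) (V : topologicalType)
    (m n : nat) (f : T -> 'M[V]_(m, n)) (l : 'M[V]_(m, n)) :
  (forall i j, f t i j @[t --> F] --> l i j) -> f t @[t --> F] --> l.
Proof.
move=> fl B [P Pl PB]; rewrite /nbhs /=.
apply: (@filterS _ F FF (fun t => forall i j, P i j (f t i j))).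
  by move=> t Pt; exact: PB.
apply: filter_forall => i; apply: filter_forall => j.
exact: fl (Pl i j).
Qed.

Lemma cvg_mulmx_col0 (R : realType) (m n : nat) (B : 'M[R]_(m, n))
    (u : nat -> 'cV[R]_n) :
  (forall j, u k j 0 @[k --> \oo] --> (0 : R)) ->
  forall i, (B *m u k) i 0 @[k --> \oo] --> (0 : R).
Proof.
move=> u0 i; under eq_fun do rewrite mxE.
have : \sum_j B i j * u k j 0 @[k --> \oo] --> \sum_j B i j * 0.
  by apply: (cvg_big (@add_continuous R)) => j _; apply: cvgM;
    [exact: cvg_cst|exact: u0].
by rewrite (big1 _ xpredT) // => j _; rewrite mulr0.
Qed.

Section SOR.
Variables (R : realType) (d : nat) (A : 'M[R]_d).
Hypothesis hA : spd A.

Lemma spd_diag_gt0 (i : 'I_d) : 0 < A i i.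
Proof.
have e0 : delta_mx i 0 != 0 :> 'cV[R]_d.
  by apply/eqP => /matrixP/(_ i 0); rewrite !mxE !eqxx => /eqP; rewrite oner_eq0.
have := hA.2 _ e0.
by rewrite trmx_delta -mulmxA -colE -rowE !mxE.
Qed.

Lemma spd_bilinC (u v : 'cV[R]_d) : (u^T *m A *m v) 0 0 = (v^T *m A *m u) 0 0.
Proof.
transitivity ((u^T *m A *m v)^T 0 0); first by rewrite [RHS]mxE.
by rewrite !trmx_mul trmxK hA.1 mulmxA.
Qed.

(** Exact second-order Taylor expansion at [x]: the residual [b - A *m x] is minus the gradient, and
    [A] is the Hessian. *)
Lemma quad_objD (b x u : 'cV[R]_d) :
  quad_obj A b (x + u) = quad_obj A b x
    + 2^-1 * (u^T *m A *m u) 0 0 - (u^T *m (b - A *m x)) 0 0.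
Proof.
have bu : (b^T *m u) 0 0 = (u^T *m b) 0 0.
  transitivity ((b^T *m u)^T 0 0); first by rewrite [RHS]mxE.
  by rewrite trmx_mul trmxK.
rewrite /quad_obj [(x + u)^T]linearD /= mulmxBr !mulmxDl !mulmxDr mulmxA.
have -> (M N : 'M[R]_1) : (M - N) 0 0 = M 0 0 - N 0 0 by rewrite !mxE.
have E (M N : 'M[R]_1) : (M + N) 0 0 = M 0 0 + N 0 0 by rewrite !mxE.
by rewrite !E (spd_bilinC x u) bu; field.
Qed.

(** Taylor expansion around [invmx A *m b], where the gradient vanishes. It yields both the lower
    bound on the objective along the iterates and the strict minimality. *)
Lemma quad_obj_minimizer (b x : 'cV[R]_d) :
  quad_obj A b x = quad_obj A b (invmx A *m b)
    + 2^-1 * ((x - invmx A *m b)^T *m A *m (x - invmx A *m b)) 0 0.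
Proof.
rewrite -{1}(subrKC (invmx A *m b) x) quad_objD.
by rewrite mulKVmx ?spd_unitmx // subrr mulmx0 [X in _ - X]mxE subr0.
Qed.

Variable c : R.
Hypothesis hc : 0 < c < 2.

Let c_gt0 : 0 < c. Proof. by case/andP: hc. Qed.

Definition sor_mx : 'M[R]_d :=
  \matrix_(i, j) (if (j < i)%N then A i j else if i == j then A i i / c else 0).

Lemma sor_mx_sym : sor_mx + sor_mx^T = A + (2 / c - 1) *: diag_mx (\row_i A i i).
Proof.
apply/matrixP => i j; rewrite !mxE (eq_sym j i).
have [<-|ij] := eqVneq i j.
  by rewrite ltnn mulr1n; field; rewrite ?gt_eqF //.
rewrite mulr0 addr0.
have Aji : A j i = A i j by rewrite -{1}hA.1 mxE.
case: ltngtP => [ji|ji|/val_inj/eqP]; last by rewrite eq_sym (negbTE ij).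
- by rewrite addr0.
- by rewrite add0r.
Qed.

(** A quadratic form depends only on the symmetric part of its matrix, and [sor_mx_sym] gives twice
    that part. *)
Lemma sor_mx_sqr (u : 'cV[R]_d) :
  (u^T *m sor_mx *m u) 0 0 = 2^-1 * (u^T *m A *m u) 0 0
    + (c^-1 - 2^-1) * \sum_i A i i * u i 0 ^+ 2.
Proof.
have tM : (u^T *m sor_mx^T *m u) 0 0 = (u^T *m sor_mx *m u) 0 0.
  transitivity ((u^T *m sor_mx^T *m u)^T 0 0); first by rewrite [RHS]mxE.
  by rewrite !trmx_mul !trmxK mulmxA.
have dM : (u^T *m diag_mx (\row_i A i i) *m u) 0 0 = \sum_i A i i * u i 0 ^+ 2.
  rewrite mxE; apply: eq_bigr => i _.
  by rewrite mul_mx_diag !mxE; ring.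
have := congr1 (fun M => (u^T *m M *m u) 0 0) sor_mx_sym.
rewrite !mulmxDr !mulmxDl -scalemxAr -scalemxAl.
have E (M N : 'M[R]_1) : (M + N) 0 0 = M 0 0 + N 0 0 by rewrite !mxE.
by rewrite !E [X in _ = _ + X]mxE tM dM => H; lra.
Qed.

Lemma sor_sweep_increment (b x y : 'cV[R]_d) :
  sor_sweep A b c x y -> sor_mx *m (y - x) = b - A *m x.
Proof.
move=> xy; apply/colP => i.
have Aii := spd_diag_gt0 i.
(* The sweep equation at [i], cleared of its denominator. The old entries with j < i are still
   missing from the sum; the strictly lower part of [sor_mx *m (y - x)] supplies them. *)
have key : A i i / c * (y i 0 - x i 0) = b i 0
    - \sum_(j < d | (j < i)%N) A i j * y j 0
    - \sum_(j < d | (i < j)%N) A i j * x j 0 - A i i * x i 0.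
  by rewrite {1}(xy i) /sor_xi; field; rewrite ?gt_eqF //.
have splitE (F : 'I_d -> R) : \sum_j F j = \sum_(j < d | (j < i)%N) F j
    + F i + \sum_(j < d | (i < j)%N) F j.
  rewrite (bigID (fun j : 'I_d => (j < i)%N)) /= -addrA; congr (_ + _).
  rewrite (bigD1 i) ?ltnn //=; congr (_ + _); apply: eq_bigl => j.
  by rewrite -leqNgt ltn_neqAle eq_sym andbC.
rewrite !mxE !splitE !mxE ltnn eqxx key.
(* [sor_mx] vanishes above the diagonal. *)
rewrite [X in _ + X](big1 _ _ _) => [|j ij]; last first.
  by rewrite mxE ltnNge (ltnW ij) /= (ltn_eqF ij : (i == j) = false) mul0r.
rewrite (eq_bigr (fun j => A i j * y j 0 - A i j * x j 0)) => [|j ji]; last first.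
  by rewrite !mxE ji mulrBr.
by rewrite sumrB; ring.
Qed.

(** With u = y - x, the linear Taylor term is u^T M u by [sor_sweep_increment]; subtracting half of
    u^T A u leaves only the diagonal part of [sor_mx_sqr]. *)
Lemma sor_sweep_decrease (b x y : 'cV[R]_d) : sor_sweep A b c x y ->
  quad_obj A b x - quad_obj A b y
    = (c^-1 - 2^-1) * \sum_i A i i * (y - x) i 0 ^+ 2.
Proof.
move=> xy; rewrite -{1}(subrKC x y) quad_objD -(sor_sweep_increment b x y xy).
by rewrite mulmxA sor_mx_sqr; ring.
Qed.

Lemma sor_increment_cvg0 (b x1 : 'cV[R]_d) (x : nat -> 'cV[R]_d) :
  sor_iterates A b c x1 x ->
  forall i, (x k.+1 - x k) i 0 @[k --> \oo] --> (0 : R).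
Proof.
move=> [_ xS] i.
(* The bound c < 2 enters here: it makes every sweep a descent step. *)
have c0 : 0 < c^-1 - 2^-1.
  by case/andP: hc => _ c2; rewrite subr_gt0 ltf_pV2 ?posrE.
have Aii := spd_diag_gt0 i.
pose q k := quad_obj A b (x k).
(* Only the [i]-th term of the decrease is kept; the others are nonnegative. *)
have qS k : (c^-1 - 2^-1) * A i i * (x k.+1 - x k) i 0 ^+ 2 <= q k - q k.+1.
  rewrite (sor_sweep_decrease b _ _ (xS k)) -mulrA ler_pM2l //.
  rewrite (bigD1 i) //= lerDl sumr_ge0 // => j _.
  by rewrite mulr_ge0 ?sqr_ge0 ?ltW ?spd_diag_gt0.
have q_ge k : quad_obj A b (invmx A *m b) <= q k.
  rewrite /q (quad_obj_minimizer b (x k)) lerDl mulr_ge0 ?invr_ge0 //.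
  have [->|/hA.2/ltW//] := eqVneq (x k - invmx A *m b) 0.
  by rewrite mulmx0 mxE.
have a0 : 0 < (c^-1 - 2^-1) * A i i by rewrite mulr_gt0.
have q_cvg : cvgn q.
  apply: nonincreasing_is_cvgn.
    apply/nonincreasing_seqP => k; rewrite -subr_ge0.
    by apply: le_trans (qS k); rewrite pmulr_rge0 ?sqr_ge0.
  by exists (quad_obj A b (invmx A *m b)) => _ [k _ <-]; exact: q_ge.
(* The convergent sequence [q] and its shift have the same limit. *)
have dq0 : q k - q k.+1 @[k --> \oo] --> (0 : R).
  rewrite -(subrr (limn q)); apply: cvgB => //.
  by rewrite (cvg_shiftS q (nbhs (limn q))).
have sqr0 : (x k.+1 - x k) i 0 ^+ 2 @[k --> \oo] --> (0 : R).
  apply: (@squeeze_cvgr _ _ _ _ (fun=> 0)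
      (fun k => ((c^-1 - 2^-1) * A i i)^-1 * (q k - q k.+1))).
  - by near=> k; rewrite sqr_ge0 /= ler_pdivlMl.
  - exact: cvg_cst.
  - rewrite -(mulr0 ((c^-1 - 2^-1) * A i i)^-1).
    by apply: cvgM => //; exact: cvg_cst.
(* From squares back to entries: |t| is the square root of t^2, and the square root is continuous at
   0. *)
apply/norm_cvg0P.
under eq_fun do rewrite -sqrtr_sqr.
rewrite -(sqrtr0 R).
exact: (cvg_comp _ _ sqr0 (@sqrt_continuous R 0)).
Unshelve. all: by end_near. Qed.

Lemma sor_iterates_cvg (b x1 : 'cV[R]_d) (x : nat -> 'cV[R]_d) :
  sor_iterates A b c x1 x -> x k @[k --> \oo] --> invmx A *m b.
Proof.
move=> hx.
have xE k : x k = invmx A *m b - (invmx A *m sor_mx) *m (x k.+1 - x k).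
  rewrite -mulmxA (sor_sweep_increment b _ _ (hx.2 k)) mulmxBr.
  by rewrite mulKmx ?spd_unitmx // subKr.
apply: cvg_mx => i j; rewrite ord1.
have -> : (fun k => x k i 0) = (fun k => (invmx A *m b) i 0
    - ((invmx A *m sor_mx) *m (x k.+1 - x k)) i 0).
  by apply/funext => k; rewrite {1}xE [LHS]mxE [X in _ + X]mxE.
have := cvgB (cvg_cst ((invmx A *m b) i 0))
  (cvg_mulmx_col0 _ _ _ (invmx A *m sor_mx) (fun k => x k.+1 - x k)
    (sor_increment_cvg0 b x1 x hx) i).
by rewrite subr0; apply.
Qed.

End SOR.

Theorem theorem5 (R : realType) (d : nat) (A : 'M[R]_d) (b : 'cV[R]_d)
    (c : R) (hA : spd A) (hc : 0 < c < 2) :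
  (forall y : 'cV[R]_d, y != invmx A *m b ->
     quad_obj A b (invmx A *m b) < quad_obj A b y) /\
  (forall (x1 : 'cV[R]_d) (x : nat -> 'cV[R]_d), sor_iterates A b c x1 x ->
     x k @[k --> \oo] --> invmx A *m b).
Proof.
split=> [y yx|x1 x]; last exact: sor_iterates_cvg.
rewrite (quad_obj_minimizer R d A hA b y) ltrDl mulr_gt0 ?invr_gt0 //.
by apply: hA.2; rewrite subr_eq0.
Qed.
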